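(* Let $p = 2$ and let $q$ be an odd prime number. Then the energy of the line graph $L(\Gamma(\mathbb{Z}_{2q}))$ is $2q-4$.
   Context: For a positive integer $n$, $\mathbb{Z}_n$ is the ring of residue classes modulo $n$. The zero-divisor graph $\Gamma(\mathbb{Z}_n)$ is the simple undirected graph whose vertices are the nonzero zero-divisors of $\mathbb{Z}_n$ (nonzero $x \in \mathbb{Z}_n$ such that $xy = 0$ for some nonzero $y \in \mathbb{Z}_n$), with distinct vertices $x,y$ adjacent if and only if $xy=0$. The line graph $L(\Gamma(\mathbb{Z}_n))$ is the graph whose vertices are the edges of $\Gamma(\mathbb{Z}_n)$, two distinct vertices being adjacent if the corresponding edges share a common vertex in $\Gamma(\mathbb{Z}_n)$. The energy of a finite graph is the sum of the absolute values of the eigenvalues (counted with multiplicity) of its adjacency matrix. *)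

(* Defs.v *)
From HB Require Import structures.
From mathcomp Require Import all_boot all_order all_algebra all_field.

Set Implicit Arguments.
Unset Strict Implicit.
Unset Printing Implicit Defensive.

Import Order.TTheory GRing.Theory Num.Theory.
Local Open Scope ring_scope.

Record sgraph := SGraph {
  vertex :> finType;
  adj : rel vertex;
  adj_sym : symmetric adj;
  adj_irrefl : irreflexive adj }.

Section ZeroDivisorGraph.
Variable R : finComNzRingType.

Definition zero_divisor (x : R) : bool := [exists y : R, (y != 0) && (x * y == 0)].

Definition zdg_vertex : finType := {x : R | (x != 0) && zero_divisor x}.

Definition zdg_adj : rel zdg_vertex :=
  fun x y => (x != y) && (val x * val y == 0).

Lemma zdg_adj_sym : symmetric zdg_adj.
Proof. by move=> x y; rewrite /zdg_adj eq_sym mulrC. Qed.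

Lemma zdg_adj_irrefl : irreflexive zdg_adj.
Proof. by move=> x; rewrite /zdg_adj eqxx. Qed.

Definition zero_divisor_graph : sgraph := SGraph zdg_adj_sym zdg_adj_irrefl.

End ZeroDivisorGraph.

Section LineGraph.
Variable G : sgraph.

Definition is_edge (e : {set G}) : bool :=
  [exists x : G, exists y : G, adj x y && (e == [set x; y])].

Definition edge : finType := {e : {set G} | is_edge e}.

Definition line_adj : rel edge :=
  fun e f => (e != f) && [exists x : G, (x \in val e) && (x \in val f)].

Lemma line_adj_sym : symmetric line_adj.
Proof.
move=> e f; rewrite /line_adj eq_sym; congr andb.
by apply: eq_existsb => x; rewrite andbC.
Qed.

Lemma line_adj_irrefl : irreflexive line_adj.
Proof. by move=> e; rewrite /line_adj eqxx. Qed.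

Definition line_graph : sgraph := SGraph line_adj_sym line_adj_irrefl.

End LineGraph.

Definition adjacency_matrix (G : sgraph) : 'M[algC]_#|G| :=
  \matrix_(i, j) (adj (enum_val i) (enum_val j))%:R.

(* The roots of the characteristic polynomial in algC, each repeated according
   to its multiplicity; an integer matrix has all its complex eigenvalues
   in algC. *)
Definition eigenvalues n (A : 'M[algC]_n) : seq algC :=
  sval (closed_field_poly_normal (char_poly A)).

Lemma char_poly_eigenvalues n (A : 'M[algC]_n) :
  char_poly A = \prod_(z <- eigenvalues A) ('X - z%:P).
Proof.
rewrite /eigenvalues; case: closed_field_poly_normal => s /= {1}->.
by rewrite (monicP (char_poly_monic A)) scale1r.
Qed.

Definition energy (G : sgraph) : algC :=
  \sum_(z <- eigenvalues (adjacency_matrix G)) `|z|.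

(* Main.v *)
(** The zero-divisor graph of Z_(2q) is a star centred at q: a product of two
    nonzero residues vanishes only if one of them is q, and the vertices are the
    q nonzero non-units.  Its line graph is therefore complete on q - 1
    vertices.  The adjacency matrix A = J - 1 of the complete graph on n vertices
    has its eigenvalues z in {-1, n - 1}, where n * |z| = (n - 2) * z + 2 (n - 1);
    as the trace of A vanishes, summing this affine identity gives the energy
    2 (n - 1). *)
Require Import Defs.
From mathcomp Require Import all_boot all_order all_algebra all_field.
From mathcomp Require Import zify ring.

Set Implicit Arguments.
Unset Strict Implicit.
Unset Printing Implicit Defensive.

Import Order.TTheory GRing.Theory Num.Theory.
Local Open Scope ring_scope.

Lemma size_eigenvalues n (A : 'M[algC]_n) : size (eigenvalues A) = n.
Proof.
by have := size_char_poly A; rewrite char_poly_eigenvalues size_prod_XsubC => -[].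
Qed.

(** Vieta: both sides are minus the coefficient of degree [n - 1] in the characteristic
    polynomial. *)
Lemma sum_eigenvalues n (A : 'M[algC]_n) :
  (0 < n)%N -> \sum_(z <- eigenvalues A) z = \tr A.
Proof.
move=> n_gt0; apply: oppr_inj; rewrite -char_poly_trace // char_poly_eigenvalues.
by rewrite -[X in _`_X.-1](size_eigenvalues A) coefPn_prod_XsubC // size_eigenvalues -lt0n.
Qed.

Lemma mem_eigenvalues n (A : 'M[algC]_n) z :
  (z \in eigenvalues A) = eigenvalue A z.
Proof. by rewrite eigenvalue_root_char char_poly_eigenvalues root_prod_XsubC. Qed.

Definition complete (G : sgraph) := forall x y : G, adj x y = (x != y).

(** The all-ones matrix satisfies [J *m J = n *: J], and an eigenvector [v] of [J - 1] for [z] has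
    [v *m J = (z + 1) *: v]. Applying [J] twice shows that [(z + 1) * (z + 1 - n)] kills [v]. *)
Lemma complete_eigenvalue (G : sgraph) z : complete G ->
  eigenvalue (adjacency_matrix G) z -> z = -1 \/ z = #|G|%:R - 1.
Proof.
move=> Gcomp /eigenvalueP [v vA v_neq0].
pose J : 'M[algC]_#|G| := const_mx 1.
have AJ : adjacency_matrix G = J - 1%:M.
  apply/matrixP => i j; rewrite !mxE Gcomp (inj_eq enum_val_inj).
  by case: eqP => _; rewrite ?subrr ?subr0.
have JJ : J *m J = #|G|%:R *: J.
  apply/matrixP => i j; rewrite !mxE (eq_bigr (fun=> 1)) => [|k _].
    by rewrite sumr_const card_ord mulr1.
  by rewrite !mxE mulr1.
have vJ : v *m J = (z + 1) *: v.
  by move: vA; rewrite AJ mulmxBr mulmx1 scalerDl scale1r => <-; rewrite subrK.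
have : (z + 1) * (z + 1 - #|G|%:R) *: v == 0.
  rewrite mulrBr scalerBl -scalerA -!vJ scalemxAl -vJ -mulmxA JJ.
  by rewrite -scalemxAr vJ scalerA mulrC subrr.
rewrite scaler_eq0 (negPf v_neq0) orbF mulf_eq0 addr_eq0 => /orP[/eqP|]; first by left.
by rewrite subr_eq0 => /eqP <-; right; rewrite addrK.
Qed.

Lemma energy_complete (G : sgraph) : complete G -> (0 < #|G|)%N ->
  energy G = 2 * #|G|%:R - 2.
Proof.
move=> Gcomp G_gt0; rewrite /energy; set n := #|G|; set A := adjacency_matrix G.
have n_neq0 : n%:R != 0 :> algC by rewrite pnatr_eq0 -lt0n.
have trA : \tr A = 0.
  by rewrite /mxtrace big1 // => i _; rewrite mxE adj_irrefl.
have n1E : n%:R - 1 = n.-1%:R :> algC by rewrite -subn1 natrB.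
(* Interpolating the absolute value affinely at the two possible eigenvalues makes their
   multiplicities irrelevant to the sum. *)
have normE z : z \in eigenvalues A ->
    n%:R * `|z| = (n%:R - 2) * z + 2 * (n%:R - 1).
  rewrite mem_eigenvalues => /(complete_eigenvalue Gcomp) [] ->.
    by rewrite normrN1; ring.
  by rewrite -/n {1}n1E normr_nat -n1E; ring.
apply: (mulfI n_neq0); rewrite mulr_sumr big_seq (eq_bigr _ normE) -big_seq.
rewrite big_split /= -mulr_sumr sum_eigenvalues // trA mulr0 add0r.
rewrite big_const_seq count_predT size_eigenvalues iter_addr_0 -/n.
by rewrite -mulr_natl; ring.
Qed.

Definition star_at (G : sgraph) (c : G) :=
  forall x y : G, adj x y = (x == c) (+) (y == c).

Lemma star_edgeE (G : sgraph) (c : G) (e : {set G}) : star_at c ->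
  is_edge e = (e \in [set [set c; x] | x in [set~ c]]).
Proof.
move=> Gstar; apply/idP/imsetP.
  case/existsP => x /existsP [y /andP[]]; rewrite Gstar.
  have [-> /=|xc /= /eqP ->] := eqVneq x c => [yc /eqP ->|/eqP ->].
    by exists y => //; rewrite !inE.
  by exists x; rewrite ?inE // setUC.
case=> x; rewrite !inE => xc ->; apply/existsP; exists c; apply/existsP; exists x.
by rewrite Gstar !eqxx (negPf xc).
Qed.

(** All edges of a star pass through its centre, so any two of them meet there. *)
Lemma complete_line_star (G : sgraph) (c : G) :
  star_at c -> complete (line_graph G).
Proof.
move=> Gstar e f; rewrite /= /line_adj andb_idr // => _; apply/existsP; exists c.
have cin (g : edge G) : c \in val g.
  by have := valP g; rewrite /= (star_edgeE _ Gstar) => /imsetP[x _ ->]; rewrite !inE eqxx.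
by rewrite !cin.
Qed.

Lemma card_line_star (G : sgraph) (c : G) :
  star_at c -> #|line_graph G| = #|G|.-1.
Proof.
move=> Gstar; rewrite /= card_sig.
rewrite (eq_card (B := [set [set c; x] | x in [set~ c]])); last first.
  by move=> e; rewrite -(star_edgeE _ Gstar).
rewrite card_in_imset ?cardsC1 // => x y; rewrite !inE => xc _ /setP /(_ x).
by rewrite !inE eqxx orbT (negPf xc) => /esym/eqP.
Qed.

(** If no nonzero [y] is killed by [x], multiplication by [x] is injective, hence bijective by
    finiteness, and so reaches 1. *)
Lemma zero_divisorE (R : finComUnitRingType) (x : R) :
  zero_divisor x = (x \isn't a GRing.unit).
Proof.
apply/existsP/idP => [[y /andP[y0 /eqP xy0]]|].
  by apply: contraNN y0 => xu; rewrite -(mulKr xu y) xy0 mulr0.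
move=> x_nu; apply/existsP; apply: contraNT x_nu => /existsPn nz.
have inj_x : injective ( *%R x).
  move=> y z /eqP; rewrite -subr_eq0 -mulrBr => xyz.
  by have := nz (y - z); rewrite xyz andbT negbK subr_eq0 => /eqP.
by apply/unitrPr; exists (invF inj_x 1); rewrite (f_invF inj_x).
Qed.

Lemma card_zero_divisor_graph_Zp n : (1 < n)%N ->
  #|zero_divisor_graph 'Z_n| = (n - totient n).-1.
Proof.
move=> n_gt1; have n_gt0 := ltnW n_gt1; pose U := [pred x : 'Z_n | x \is a GRing.unit].
have cardU : #|U| = totient n by rewrite -(card_units_Zp n_gt0) cardsT card_sub.
have <- : #|predC U| = (n - totient n)%N.
  have cardZ : #|'Z_n| = n by rewrite card_ord Zp_cast.
  by rewrite -cardU -[X in (X - _)%N]cardZ -(cardC U) addKn.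
(* Zero is a non-unit but not a vertex, whence the predecessor. *)
rewrite (cardD1 0) !inE unitr0 card_sig; apply: eq_card => x.
by rewrite !inE zero_divisorE.
Qed.

(** Strictly between 0 and [2 * q], the only multiple of [q] is [q] itself, and a number not coprime
    to [2 * q] is even or equal to [q]. So divisibility of the product asks for one factor [q] and
    an even one, which differs from the odd [q]. *)
Lemma dvdn_double_prime_star q a b : prime q -> odd q ->
    (0 < a < 2 * q)%N -> ~~ coprime (2 * q) a ->
    (0 < b < 2 * q)%N -> ~~ coprime (2 * q) b ->
  (a != b) && (2 * q %| a * b)%N = (a == q) (+) (b == q).
Proof.
move=> q_pr q_odd.
have q_dvd c : (0 < c < 2 * q)%N -> (q %| c)%N = (c == q).
  move=> c_bnd; apply/idP/eqP => [/dvdnP[k ck]|-> //].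
  by case: k ck => [|[|k]] ck; nia.
have even_or_q c : (0 < c < 2 * q)%N -> ~~ coprime (2 * q) c -> ~~ odd c || (c == q).
  move=> c_bnd; rewrite coprimeMl negb_and coprime2n.
  by rewrite prime_coprime // negbK q_dvd.
have dvd2q c : (2 * q %| c)%N = ~~ odd c && (q %| c)%N.
  by rewrite Gauss_dvd ?coprime2n // dvdn2.
move=> a_bnd /(even_or_q _ a_bnd) a_nu b_bnd /(even_or_q _ b_bnd) b_nu.
rewrite dvd2q Euclid_dvdM // !q_dvd // oddM.
have [aq|aq] := eqVneq a q; have [bq|bq] := eqVneq b q; rewrite /= ?andbF //.
- by rewrite aq bq eqxx.
- by rewrite aq eq_sym bq; move: b_nu; rewrite (negPf bq) orbF => /negPf->; rewrite andbF.
- by rewrite bq aq; move: a_nu; rewrite (negPf aq) orbF => /negPf->.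
Qed.

Lemma star_zero_divisor_graph_Z2q q : prime q -> odd q ->
  exists c : zero_divisor_graph 'Z_(2 * q), star_at c.
Proof.
move=> q_pr q_odd; have q_gt2 := odd_prime_gt2 q_odd q_pr.
have n_gt1 : (1 < 2 * q)%N by lia.
have unitE (x : 'Z_(2 * q)) : (x \is a GRing.unit) = coprime (2 * q) x.
  by rewrite -unitZpE // natr_Zp.
have q_val : (q%:R : 'Z_(2 * q)) = q :> nat.
  by rewrite val_Zp_nat // modn_small //; lia.
have q_vertex : ((q%:R : 'Z_(2 * q)) != 0) && zero_divisor (q%:R : 'Z_(2 * q)).
  rewrite zero_divisorE unitE -val_eqE q_val coprimeMl negb_and [coprime q q]/coprime gcdnn.
  by apply/andP; split; last lia; rewrite [\val _]q_val -lt0n ltnW // ltnW.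
pose c : zero_divisor_graph 'Z_(2 * q) := Sub (q%:R : 'Z_(2 * q)) q_vertex.
have vertexP (x : zero_divisor_graph 'Z_(2 * q)) :
    (0 < (val x : nat) < 2 * q)%N /\ ~~ coprime (2 * q) (val x).
  have /andP[x0 xnu] := valP x; rewrite zero_divisorE unitE in xnu; split=> //.
  by rewrite lt0n x0 -[X in (_ < X)%N](Zp_cast n_gt1) ltn_ord.
have eqE (x y : zero_divisor_graph 'Z_(2 * q)) :
  (x == y) = ((val x : nat) == (val y : nat)) by [].
exists c => x y; have [[x_bnd xnu] [y_bnd ynu]] := (vertexP x, vertexP y).
rewrite !eqE [nat_of_ord (val c)]q_val -dvdn_double_prime_star //.
(* Once the modulus built into the ring type is cast back to [2 * q], a vanishing product is
   divisibility by definition. *)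
by rewrite /= /zdg_adj -[val x * val y == 0]val_eqE /= [X in (_ %% X)%N]Zp_cast.
Qed.

Theorem theorem3p1 (p q : nat) (hp : p = 2%N) (hq : prime q) (hq_odd : odd q) :
  energy (line_graph (zero_divisor_graph 'Z_(p * q))) = 2 * q%:R - 4.
Proof.
have q_gt2 := odd_prime_gt2 hq_odd hq.
rewrite hp; have [c c_star] := star_zero_divisor_graph_Z2q hq hq_odd.
have cardL : #|line_graph (zero_divisor_graph 'Z_(2 * q))| = q.-1.
  rewrite (card_line_star c_star) card_zero_divisor_graph_Zp; last by lia.
  (* Here [totient (2 * q)] is [q - 1], so the star has [q] vertices and [q - 1] edges. *)
  rewrite totient_coprime ?coprime2n // (@totient_prime 2) // totient_prime //.
  by lia.
rewrite (energy_complete (complete_line_star c_star)) cardL; last by lia.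
by rewrite -subn1 natrB ?prime_gt0 //; ring.
Qed.
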